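(* Let $\epsilon,\delta\in(0,1)$, let $\mathcal F$ be a class of NE approximators, or a class of CE approximators, or a class of CCE approximators, and let $\mathcal D$ be a probability distribution on the payoff set $\mathcal U$. Let $L=2n$ for NE approximators and $L=2$ for CE and CCE approximators. If $$m\ \ge\ \frac{9}{2\epsilon^2}\Big(\ln\frac2\delta+\ln\mathcal N_\infty\big(\mathcal F,\tfrac{\epsilon}{3L}\big)\Big),$$ then with probability at least $1-\delta$ over the draw of a training set $S$ of $m$ games sampled i.i.d. from $\mathcal D$, for all $f\in\mathcal F$ we have $$\mathbb E_{u\sim\mathcal D}[\mathcal E(f(u),u)]\ \le\ \frac1m\sum_{u\in S}\mathcal E(f(u),u)+\epsilon.$$
   Context: Fix a number of players $n\ge2$ and finite action sets $\mathcal A_i=\{1,\dots,m_i\}$, $i\in[n]$; $\mathcal A=\prod_{i}\mathcal A_i$. A payoff is $u=(u_i)_{i\in[n]}$ with $u_i:\mathcal A\to[0,1]$; $\mathcal U$ is the set of all payoffs. A joint strategy is $\pi\in\Delta\mathcal A$; a product strategy is $\sigma=(\sigma_i)_{i\in[n]}$, $\sigma_i\in\Delta\mathcal A_i$, identified with the corresponding product distribution. $u_i(\pi)=\sum_a\pi(a)u_i(a)$ and $u_i(a_i',\pi_{-i})=\sum_{a}\pi(a)u_i(a_i',a_{-i})$. Exploitability: $\mathcal E_i(\pi,u)=\max_{a_i'\in\mathcal A_i}u_i(a_i',\pi_{-i})-u_i(\pi)$ and $\mathcal E_i^{\mathrm{CE}}(\pi,u)=\max_{\phi_i:\mathcal A_i\to\mathcal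 A_i}\sum_a\pi(a)u_i(\phi_i(a_i),a_{-i})-u_i(\pi)$. The equilibrium approximation is $\mathcal E(\pi,u)=\max_i\mathcal E_i(\pi,u)$ in the NE and CCE cases, and $\mathcal E(\pi,u)=\max_i\mathcal E^{\mathrm{CE}}_i(\pi,u)$ in the CE case. An NE approximator is a map $f:\mathcal U\to\prod_i\Delta\mathcal A_i$; a CE (resp. CCE) approximator is a map $f:\mathcal U\to\Delta\mathcal A$ (with no requirement that outputs be equilibria). Approximators are tacitly measurable. Distances: $\|\sigma-\sigma'\|=\max_i\sum_{a_i}|\sigma_i(a_i)-\sigma_i'(a_i)|$ for product strategies, $\|\pi-\pi'\|=\sum_a|\pi(a)-\pi'(a)|$ for joint strategies; $\ell_\infty(f,g)=\sup_{u\in\mathcal U}\|f(u)-g(u)\|$. A class $\mathcal F_r$ of approximators of the same type (not required to be contained in $\mathcal F$) $r$-covers $\mathcal F$ if for every $f\in\mathcal F$ there is $f_r\in\mathcal F_r$ with $\ell_\infty(f,f_r)\le r$. $\mathcal N_\infty(\mathcal F,r)$ is the smallest cardinality of a class that $r$-covers $\mathcal F$ ($+\infty$ if no finite one exists). *)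

(* Defs.v *)
From HB Require Import structures.
From mathcomp Require Import all_boot all_order all_algebra.
From mathcomp Require Import all_classical all_reals all_analysis.
Import Order.TTheory GRing.Theory Num.Theory.
Import numFieldNormedType.Exports.

Set Implicit Arguments.
Unset Strict Implicit.
Unset Printing Implicit Defensive.

Local Open Scope classical_set_scope.
Local Open Scope ring_scope.

(* A game with n players is described by k : 'I_n -> nat, player i having
   (k i).+1 actions, so that every action set is finite and nonempty. *)
Definition action n (k : 'I_n -> nat) (i : 'I_n) := 'I_(k i).+1.

Definition profile n (k : 'I_n -> nat) := {dffun forall i : 'I_n, action k i}.

Definition deviate n (k : 'I_n -> nat) (a : profile k) (i : 'I_n)
    (b : action k i) : profile k :=
  finfun (eqtype.dfwith (T := action k) a b).

(* The maximum of F when T is nonempty. A bigop max with default 0 would be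
   wrong: the deviation gains of a correlated strategy can all be negative. *)
Definition fmax (R : realType) (T : finType) (F : T -> R) : R := sup (range F).

Record distr (R : realType) (T : finType) := Distr {
  distr_fun :> T -> R;
  distr_ge0 : forall x, 0 <= distr_fun x;
  distr_sum1 : \sum_x distr_fun x = 1 }.

Section dirac_distr.
Context (R : realType) (T : finType) (x0 : T).

Let dirac_fun (x : T) : R := (x == x0)%:R.

Lemma dirac_fun_ge0 x : 0 <= dirac_fun x.
Proof. exact: ler0n. Qed.

Lemma dirac_fun_sum1 : \sum_x dirac_fun x = 1.
Proof.
rewrite (bigD1 x0) //= /dirac_fun eqxx big1 ?addr0// => x xx0.
by rewrite (negbTE xx0).
Qed.

Definition dirac_distr : distr R T := Distr dirac_fun_ge0 dirac_fun_sum1.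

End dirac_distr.

Record payoff (R : realType) n (k : 'I_n -> nat) := Payoff {
  payoff_fun :> 'I_n -> profile k -> R;
  payoff_itv : forall i a, 0 <= payoff_fun i a <= 1 }.

Record joint_strategy (R : realType) n (k : 'I_n -> nat) := JointStrategy {
  joint_distr :> distr R (profile k) }.

Record product_strategy (R : realType) n (k : 'I_n -> nat) :=
  ProductStrategy { product_distr :> forall i : 'I_n, distr R (action k i) }.

(* Payoffs and strategies are points of finite-dimensional spaces; they carry
   the trace of the Borel sigma-algebra, i.e. the sigma-algebra generated by
   their real coordinates. *)
Definition coord_system (R : realType) (T I : Type) (x : I -> T -> R) :
    set (set T) :=
  <<s \bigcup_(i in [set: I]) preimage_set_system setT (x i) measurable >>.

Section measurable_spaces.
Context (R : realType) (n : nat) (k : 'I_n -> nat).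

Let payoff0_itv (i : 'I_n) (a : profile k) : 0 <= (0 : R) <= 1.
Proof. by rewrite lexx ler01. Qed.

HB.instance Definition _ := gen_eqMixin (payoff R k).
HB.instance Definition _ := gen_choiceMixin (payoff R k).
HB.instance Definition _ := isPointed.Build (payoff R k) (Payoff payoff0_itv).

Definition payoff_coord (ia : 'I_n * profile k) (u : payoff R k) : R :=
  u ia.1 ia.2.

HB.instance Definition _ := @isMeasurable.Build default_measure_display
  (payoff R k) (coord_system payoff_coord)
  (@sigma_algebra0 _ _ _) (@sigma_algebraC _ _)
  (@sigma_algebra_bigcup _ _ _).

HB.instance Definition _ := gen_eqMixin (joint_strategy R k).
HB.instance Definition _ := gen_choiceMixin (joint_strategy R k).
HB.instance Definition _ := isPointed.Build (joint_strategy R k)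
  (JointStrategy (dirac_distr R ([ffun i => ord0] : profile k))).

Definition joint_coord (a : profile k) (p : joint_strategy R k) : R := p a.

HB.instance Definition _ := @isMeasurable.Build default_measure_display
  (joint_strategy R k) (coord_system joint_coord)
  (@sigma_algebra0 _ _ _) (@sigma_algebraC _ _)
  (@sigma_algebra_bigcup _ _ _).

HB.instance Definition _ := gen_eqMixin (product_strategy R k).
HB.instance Definition _ := gen_choiceMixin (product_strategy R k).
HB.instance Definition _ := isPointed.Build (product_strategy R k)
  (ProductStrategy (fun i => dirac_distr R (ord0 : action k i))).

Definition product_coord (ia : {i : 'I_n & action k i})
    (s : product_strategy R k) : R := s (tag ia) (tagged ia).

HB.instance Definition _ := @isMeasurable.Build default_measure_display
  (product_strategy R k) (coord_system product_coord)
  (@sigma_algebra0 _ _ _) (@sigma_algebraC _ _)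
  (@sigma_algebra_bigcup _ _ _).

End measurable_spaces.

Section product_to_joint.
Context (R : realType) (n : nat) (k : 'I_n -> nat).
Variable s : product_strategy R k.

Let prod_fun (a : profile k) : R := \prod_i s i (a i).

Lemma prod_fun_ge0 a : 0 <= prod_fun a.
Proof. by apply: prodr_ge0 => i _; exact: distr_ge0. Qed.

Lemma prod_fun_sum1 : \sum_a prod_fun a = 1.
Proof.
pose P i := [ffun x => s i x].
transitivity (\prod_i \sum_x P i x).
  rewrite (eq_bigr _ (fun i _ => big_tag P i)).
  rewrite bigA_distr_big_dep -big_fprod (reindex (@dffun_of_fprod _ _)) /=.
    by apply: eq_bigr => f _; apply: eq_bigr => i _; rewrite !ffunE.
  exact/onW_bij/dffun_of_fprod_bij.
rewrite big1 // => i _.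
by rewrite -(distr_sum1 (s i)); apply: eq_bigr => x _; rewrite ffunE.
Qed.

Definition joint_of_product : joint_strategy R k :=
  JointStrategy (Distr prod_fun_ge0 prod_fun_sum1).

End product_to_joint.

Section exploitability.
Context (R : realType) (n : nat) (k : 'I_n -> nat).
Implicit Types (p : joint_strategy R k) (u : payoff R k) (i : 'I_n).

Definition exp_payoff p u i : R := \sum_a p a * u i a.

Definition exploit p u i : R :=
  fmax (fun b : action k i => \sum_a p a * u i (deviate a b))
  - exp_payoff p u i.

Definition exploitCE p u i : R :=
  fmax (fun phi : {ffun action k i -> action k i} =>
          \sum_a p a * u i (deviate a (phi (a i))))
  - exp_payoff p u i.

End exploitability.

Inductive solution_concept := NE | CE | CCE.

Definition strategy (R : realType) n (k : 'I_n -> nat) (c : solution_concept) :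
    measurableType default_measure_display :=
  match c with
  | NE => product_strategy R k
  | CE | CCE => joint_strategy R k
  end.

Definition approximator (R : realType) n (k : 'I_n -> nat)
    (c : solution_concept) := {mfun payoff R k >-> strategy R k c}.

Definition eq_approx (R : realType) n (k : 'I_n -> nat) (c : solution_concept) :
    strategy R k c -> payoff R k -> R :=
  match c with
  | NE => fun s u => fmax (exploit (joint_of_product s) u)
  | CE => fun p u => fmax (exploitCE p u)
  | CCE => fun p u => fmax (exploit p u)
  end.

Definition product_dist (R : realType) n (k : 'I_n -> nat)
    (s s' : product_strategy R k) : R :=
  fmax (fun i => \sum_x `|s i x - s' i x|).

Definition joint_dist (R : realType) n (k : 'I_n -> nat)
    (p p' : joint_strategy R k) : R :=
  \sum_a `|p a - p' a|.

Definition strategy_dist (R : realType) n (k : 'I_n -> nat)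
    (c : solution_concept) : strategy R k c -> strategy R k c -> R :=
  match c with
  | NE => @product_dist R n k
  | CE | CCE => @joint_dist R n k
  end.

Definition lip_const (R : realType) (n : nat) (c : solution_concept) : R :=
  match c with NE => (2 * n)%:R | CE | CCE => 2 end.

Section covering.
Context (R : realType) (n : nat) (k : 'I_n -> nat) (c : solution_concept).
Implicit Types (f g : approximator R k c) (F G : set (approximator R k c)).

Definition linfty f g : R := sup (range (fun u => strategy_dist (f u) (g u))).

Definition covers G F (r : R) :=
  forall f, F f -> exists2 g, G g & linfty f g <= r.

Definition covering_number F (r : R) : \bar R :=
  ereal_inf [set N%:R%:E | N in
    [set N : nat | exists G, (G #= `I_N)%card /\ covers G F r]].

End covering.

Section iid_sample.
Context d (T : measurableType d) (R : realType) (P : probability T R).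

Definition tcons m (x : T * m.-tuple T) : m.+1.-tuple T := [tuple of x.1 :: x.2].

Lemma measurable_tcons m : measurable_fun [set: T * m.-tuple T] (@tcons m).
Proof. by apply: measurable_cons. Qed.

HB.instance Definition _ m :=
  isMeasurableFun.Build _ _ _ _ (@tcons m) (@measurable_tcons m).

(* The m-fold product P^m, i.e. the law of m independent draws from P. *)
Fixpoint iid_sample m : probability (m.-tuple T) R :=
  match m with
  | 0 => \d_([tuple] : 0.-tuple T)
  | m'.+1 => distribution (P \x iid_sample m')%E (@tcons m')
  end.

Lemma iid_sample_box m (A : 'I_m -> set T) : (forall i, measurable (A i)) ->
  iid_sample m [set S | forall i, A i (tnth S i)] = (\prod_(i < m) P (A i))%E.
Proof.
elim: m A => [|m IHm] A mA.
  rewrite big_ord0 /= diracE mem_set//; by case.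
rewrite big_ord_recl -IHm//= /distribution /= /pushforward.
pose B := [set S : m.-tuple T | forall i, A (lift ord0 i) (tnth S i)].
rewrite -/B.
have -> : @tcons m @^-1` [set S | forall i, A i (tnth S i)] = A ord0 `*` B.
  apply/seteqP; split => [[x S] /= H|[x S] /= [Ax BS] i].
    split; first exact: (H ord0).
    by move=> i; have := H (lift ord0 i); rewrite tnthS.
  have [->|i0] := eqVneq i ord0; first by [].
  have [j ->] : exists j, i = lift ord0 j.
    by case: (unliftP ord0 i) i0 => [j ->|->]; [exists j|rewrite eqxx].
  by rewrite tnthS; exact: BS.
rewrite product_measure1E//.
have -> : B = \bigcap_(i in [set: 'I_m])
    ((@tnth m T)^~ i @^-1` A (lift ord0 i)).
  by apply/seteqP; split => [S BS i _|S BS i]; [exact: BS|exact: BS i I].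
apply: fin_bigcap_measurable => // i _.
by rewrite -[X in measurable X]setTI; exact: measurable_tnth.
Qed.

End iid_sample.

(* Main.v *)
(** A cover of radius [eps / (3 L)] reduces the uniform bound to a union bound
    over the cover and Hoeffding's inequality. For CCE approximators the
    equilibrium approximation may be negative, so it ranges over [-1, 1] and
    Hoeffding's exponent is four times smaller than for the range [0, 1]. This
    is compensated by the Lipschitz constant: the gain of a deviation is a
    linear form in the joint strategy with coefficients in [-1, 1], so the
    equilibrium approximation is (L / 2)-Lipschitz. Passing to the cover then
    costs [eps / 6] twice, which leaves [t = 2 eps / 3] for the deviation, and
    [exp (- m t ^ 2 / 2) = exp (- 2 m eps ^ 2 / 9)]. *)

Require Import Defs.
From HB Require Import structures.
From mathcomp Require Import all_boot all_order all_algebra.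
From mathcomp Require Import all_classical all_reals all_analysis.
From mathcomp Require Import measurable_realfun ring lra.
Import Order.TTheory GRing.Theory Num.Theory.
Import numFieldNormedType.Exports.

Set Implicit Arguments.
Unset Strict Implicit.
Unset Printing Implicit Defensive.

Local Open Scope classical_set_scope.
Local Open Scope ring_scope.

(** * Moment generating function of a law on {-1, 1} *)

Section two_point.
Context (R : realType).

Lemma le_at0_of_derive_le0 (f df : R -> R) :
  (forall x : R, is_derive x 1 f (df x)) -> (forall x, 0 <= x -> df x <= 0) ->
  forall x, 0 <= x -> f x <= f 0.
Proof.
move=> fdf df0 x x0.
have der y : derivable f y 1 by have [] := fdf y.
apply: (@ler0_derive1_nincry _ _ 0) => //.
- move=> y; rewrite in_itv/= andbT => /ltW y0.
  by rewrite derive1E; have [_ ->] := fdf y; exact: df0.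
- exact: derivable_within_continuous.
Qed.

Context (p q : R).
Hypotheses (p0 : 0 <= p) (q0 : 0 <= q) (pq1 : p + q = 1).

(** [D] is the moment generating function of the law with mass [p] at 1 and [q] at -1; [N] is its
    derivative, and [D] is in turn the derivative of [N]. *)
Let D (x : R) := p * expR x + q * expR (- x).
Let N (x : R) := p * expR x - q * expR (- x).

Let D_gt0 x : 0 < D x.
Proof.
have [p_gt0|p_le0] := ltP 0 p.
  by rewrite ltr_wpDr ?mulr_ge0 ?mulr_gt0 ?expR_ge0 ?expR_gt0.
have p_eq0 : p = 0 by apply/eqP; rewrite eq_le p_le0.
have q1 : q = 1 by rewrite -pq1 p_eq0 add0r.
by rewrite /D p_eq0 q1 mul0r add0r mul1r expR_gt0.
Qed.

Let is_derive_expRN (x : R) :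
  is_derive x 1 (fun y : R => expR (- y)) (- expR (- x)).
Proof.
have dN : is_derive x 1 (fun y : R => - y) (- 1) by apply: is_derive_eq.
by rewrite -mulrN1; exact: is_derive1_comp.
Qed.

Let is_derive_D (x : R) : is_derive x 1 D (N x).
Proof. by apply: is_derive_eq; rewrite /N /GRing.scale /=; ring. Qed.

Let is_derive_N (x : R) : is_derive x 1 N (D x).
Proof. by apply: is_derive_eq; rewrite /D /GRing.scale /=; ring. Qed.

Let D0 : D 0 = 1.
Proof. by rewrite /D oppr0 expR0 !mulr1. Qed.

Let N0 : N 0 = p - q.
Proof. by rewrite /N oppr0 expR0 !mulr1. Qed.

(* The logarithmic derivative [N / D] of [D] is 1-Lipschitz, its derivative
   being [1 - (N / D) ^+ 2]. *)
Let N_le x : 0 <= x -> N x <= (p - q + x) * D x.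
Proof.
move=> x0.
have dV (y : R) : is_derive y 1 (fun z : R => (D z)^-1) (- D y ^- 2 *: N y).
  by apply: is_deriveV; rewrite ?gt_eqF.
have := @le_at0_of_derive_le0 (fun y : R => N y * (D y)^-1 - y)
  (fun y => - (N y / D y) ^+ 2) _ _ _ x0.
rewrite N0 D0 divr1 subr0 => le_pq.
rewrite -ler_pdivrMr// -lerBlDr; apply: le_pq => y.
  apply: is_derive_eq; rewrite /GRing.scale /=.
  have -> : p * expR y - q * (expR (- y) * -1) = D y by rewrite /D; ring.
  by field; rewrite gt_eqF.
by move=> _; rewrite oppr_le0 sqr_ge0.
Qed.

(** With [e] the inverse of the bound, [D * e] equals 1 at 0 and has derivative
    [e * (N - (p - q + x) * D)], which [N_le] makes nonpositive on the half-line. *)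
Lemma two_point_mgf_le x : 0 <= x ->
  p * expR x + q * expR (- x) <= expR (x * (p - q) + x ^+ 2 / 2).
Proof.
move=> x0; rewrite -/(D x).
pose e (y : R) := expR (- (y * (p - q) + y ^+ 2 / 2)).
have de (y : R) : is_derive y 1 e (e y * - (p - q + y)).
  apply: is_derive1_comp; apply: is_derive_eq.
  by rewrite /GRing.scale /=; field.
suff : D x * e x <= 1 by rewrite /e expRN ler_pdivrMr ?expR_gt0// mul1r.
have <- : D 0 * e 0 = 1.
  by rewrite D0 mul1r /e mul0r expr0n/= mul0r addr0 oppr0 expR0.
apply: (@le_at0_of_derive_le0 (fun y : R => D y * e y)
  (fun y => e y * (N y - (p - q + y) * D y))) => // y.
  by apply: is_derive_eq; rewrite /N /D /GRing.scale /=; ring.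
by move=> y0; rewrite mulr_ge0_le0 ?expR_ge0// subr_le0 N_le.
Qed.

End two_point.

(** Convexity of the exponential between [- l] and [l]. The right side is affine in [x], so after
    integration only the mean of a [-1, 1]-valued variable matters. *)
Lemma expR_chord (R : realType) (l x : R) : -1 <= x <= 1 ->
  expR (l * x) <= (1 + x) / 2 * expR l + (1 - x) / 2 * expR (- l).
Proof.
move=> /andP[x_ge x_le].
have t_ge0 : 0 <= (1 + x) / 2 by lra.
have t_le1 : (1 + x) / 2 <= 1 by lra.
have := convex_expR (Itv01 t_ge0 t_le1) l (- l).
rewrite !convRE /= /unstable.onem.
have -> : 1 - (1 + x) / 2 = (1 - x) / 2 by field.
suff -> : (1 + x) / 2 * l + (1 - x) / 2 * - l = l * x by [].
by field.
Qed.

Lemma lee_wexpe (R : realDomainType) (x y : \bar R) m :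
  (0 <= x -> x <= y -> x ^+ m <= y ^+ m)%E.
Proof.
move=> x0 xy; elim: m => [|m IHm]; first by rewrite !expe0.
by rewrite !expeS; apply: lee_pmul => //; exact: expe_ge0.
Qed.

(** * Hoeffding's inequality for i.i.d. samples *)

Section hoeffding.
Context d (T : measurableType d) (R : realType) (P : probability T R).

Lemma measurable_prod_tuple (h : T -> R) m : measurable_fun setT h ->
  measurable_fun setT (fun S : m.-tuple T => \prod_(u <- S) h u).
Proof.
move=> mh; under eq_fun do rewrite big_tuple.
apply: measurable_prod => i _.
by apply: measurableT_comp => //; exact: measurable_tnth.
Qed.

Lemma measurable_sum_tuple (h : T -> R) m : measurable_fun setT h ->
  measurable_fun setT (fun S : m.-tuple T => \sum_(u <- S) h u).
Proof.
move=> mh; under eq_fun do rewrite big_tuple.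
apply: measurable_sum => i.
by apply: measurableT_comp => //; exact: measurable_tnth.
Qed.

(** Independence of the draws: Tonelli's theorem splits off the first coordinate, and induction on
    [m] handles the rest. *)
Lemma integral_iid_prod (h : T -> R) m :
  measurable_fun setT h -> (forall x, 0 <= h x) ->
  (\int[iid_sample P m]_S (\prod_(u <- S) h u)%:E
   = (\int[P]_x (h x)%:E) ^+ m)%E.
Proof.
move=> mh h0; elim: m => [|m IHm].
  rewrite /= integral_dirac// ?diracT ?mul1e ?big_nil//.
  by apply/measurable_EFinP; exact: measurable_prod_tuple.
have prod0 p (S : p.-tuple T) : 0 <= \prod_(u <- S) h u by exact: prodr_ge0.
have mprod p : measurable_fun setT
    (fun S : p.-tuple T => (\prod_(u <- S) h u)%:E).
  by apply/measurable_EFinP; exact: measurable_prod_tuple.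
rewrite ge0_integral_distribution; last 2 first.
- exact: mprod.
- by move=> S; rewrite lee_fin.
rewrite fubini_tonelli1; last 2 first.
- exact: (measurableT_comp (mprod m.+1) (@measurable_tcons _ T m)).
- by move=> z /=; rewrite lee_fin.
under eq_integral => x _.
  rewrite /fubini_F /=.
  under eq_integral => S _ do rewrite big_cons EFinM.
  rewrite ge0_integralZl//; last 3 first.
  - exact: mprod.
  - by move=> S _; rewrite lee_fin.
  - by rewrite lee_fin.
  rewrite IHm.
  over.
rewrite ge0_integralZr//; last 3 first.
- exact/measurable_EFinP.
- by move=> x _; rewrite lee_fin.
- by rewrite expe_ge0// integral_ge0// => x _; rewrite lee_fin.
by rewrite expeS.
Qed.

Lemma bounded_integrable (X : T -> R) (b : R) : measurable_fun setT X ->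
  (forall x, `|X x| <= b) -> P.-integrable setT (EFin \o X).
Proof.
move=> mX Xb; apply: measurable_bounded_integrable => //.
  by rewrite (le_lt_trans (probability_le1 P measurableT))// ltry.
exists b; split; first exact: num_real.
by move=> M bM x _ /=; rewrite (le_trans (Xb x))// ltW.
Qed.

Lemma expectation_fineK (X : T -> R) (b : R) : measurable_fun setT X ->
  (forall x, `|X x| <= b) -> (fine 'E_P[X])%:E = ('E_P[X])%E.
Proof.
move=> mX Xb; rewrite fineK// unlock.
by apply: integrable_fin_num => //; exact: bounded_integrable Xb.
Qed.

Lemma fine_expectation_leD (X Y : T -> R) (b e : R) :
  measurable_fun setT X -> measurable_fun setT Y ->
  (forall x, `|X x| <= b) -> (forall x, `|Y x| <= b) ->
  (forall x, X x <= Y x + e) -> fine 'E_P[X] <= fine 'E_P[Y] + e.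
Proof.
move=> mX mY Xb Yb XY.
rewrite -lee_fin EFinD (expectation_fineK mX Xb) (expectation_fineK mY Yb).
have iX := bounded_integrable mX Xb; have iY := bounded_integrable mY Yb.
have ie := finite_measure_integrable_cst P e measurableT.
rewrite -(expectation_cst P e) unlock -integralD//.
apply: le_integral => //; first exact: integrableD.
by move=> x _; rewrite -EFinD lee_fin.
Qed.

Section centered_mgf.
Context (X : T -> R) (l : R).
Hypotheses (mX : measurable_fun setT X) (X1 : forall x, `|X x| <= 1).
Hypothesis (l0 : 0 <= l).
Let mu := fine 'E_P[X].

(** Hoeffding's lemma: the chord bound at [- X x] replaces the law of [- X] by the law on {-1, 1}
    with the same mean, to which [two_point_mgf_le] applies. *)
Lemma centered_mgf_le :
  (\int[P]_x (expR (l * (mu - X x)))%:E <= (expR (l ^+ 2 / 2))%:E)%E.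
Proof.
have iX : P.-integrable setT (EFin \o X) by exact: bounded_integrable X1.
have EX : (\int[P]_x (X x)%:E = mu%:E)%E.
  by rewrite /mu (expectation_fineK mX X1) unlock.
have int_cst (r : R) : (\int[P]_x r%:E = r%:E)%E.
  by have := expectation_cst P r; rewrite unlock.
have mu1 : -1 <= mu <= 1.
  apply/andP; split; rewrite -lee_fin -EX.
    rewrite -[leLHS]int_cst.
    apply: le_integral => //; first exact: finite_measure_integrable_cst.
    by move=> x _; rewrite lee_fin; have := X1 x; rewrite ler_norml => /andP[].
  rewrite -[leRHS]int_cst.
  apply: le_integral => //; first exact: finite_measure_integrable_cst.
  by move=> x _; rewrite lee_fin; have := X1 x; rewrite ler_norml => /andP[].
(* [p] and [q] are the masses at 1 and -1 of the law of mean [- mu], nonnegative by [mu1];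
   [a + b * X x] is the chord bound multiplied by [expR (l * mu)]. *)
pose p := (1 - mu) / 2; pose q := (1 + mu) / 2.
pose a := expR (l * mu) * ((expR l + expR (- l)) / 2).
pose b := expR (l * mu) * ((expR (- l) - expR l) / 2).
have mg : measurable_fun setT (fun x => expR (l * (mu - X x))).
  apply: measurableT_comp => //; apply: measurable_funM => //.
  exact: measurable_funB.
have chord x : expR (l * (mu - X x)) <= a + b * X x.
  rewrite mulrBr expRD.
  have Nx1 : -1 <= - X x <= 1 by rewrite -ler_norml normrN.
  have := expR_chord l Nx1; rewrite mulrN.
  rewrite -(ler_pM2l (expR_gt0 (l * mu))) => /le_trans; apply.
  by rewrite le_eqVlt; apply/orP; left; apply/eqP; rewrite /a /b; field.
apply: (@le_trans _ _ (\int[P]_x (a + b * X x)%:E)%E).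
  apply: ge0_le_integral => //.
  - exact/measurable_EFinP.
  - apply/measurable_EFinP; apply: measurable_funD => //.
    exact: measurable_funM.
  - by move=> x _; rewrite lee_fin.
under eq_integral => x _ do rewrite EFinD (EFinM b).
rewrite integralD//; last 2 first.
- exact: finite_measure_integrable_cst.
- exact: integrableZl.
rewrite integralZl// EX int_cst.
rewrite -EFinM -EFinD lee_fin.
have := @two_point_mgf_le R p q _ _ _ l l0.
have -> : p - q = - mu by rewrite /p /q; field.
have := expR_gt0 (l * mu).
move=> e0 /(_ _ _ _)/(ler_wpM2l (ltW e0)); rewrite -expRD.
have -> : l * mu + (l * - mu + l ^+ 2 / 2) = l ^+ 2 / 2 by ring.
move=> H; apply: (le_trans _ (H _ _ _)); rewrite /p /q.
- by rewrite le_eqVlt; apply/orP; left; apply/eqP; rewrite /a /b; field.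
- by move: mu1 => /andP[]; lra.
- by move: mu1 => /andP[]; lra.
- by field.
Qed.

End centered_mgf.

(* Chernoff's method; [l = t] minimizes the exponent [l ^+ 2 / 2 - l * t]. *)
Lemma hoeffding (X : T -> R) (t : R) m :
  measurable_fun setT X -> (forall x, `|X x| <= 1) -> 0 <= t ->
  (iid_sample P m [set S : m.-tuple T |
     (m%:R * t <= \sum_(u <- S) (fine 'E_P[X] - X u))%R]
   <= (expR (- (m%:R * t ^+ 2 / 2)))%:E)%E.
Proof.
move=> mX X1 t0; set mu := fine _; set A := [set S | _].
pose h x := expR (t * (mu - X x)).
have mc : measurable_fun setT (fun x => mu - X x) by exact: measurable_funB.
have mh : measurable_fun setT h.
  by apply: measurableT_comp => //; exact: measurable_funM.
have h0 x : 0 <= h x by exact: expR_ge0.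
have mA : measurable A.
  rewrite -[A]setTI; apply: (measurable_fun_le (f := cst (m%:R * t))) => //.
  exact: measurable_sum_tuple.
pose c := expR (- (m%:R * t ^+ 2)).
have c0 : 0 <= c by exact: expR_ge0.
have -> : iid_sample P m A = (\int[iid_sample P m]_S (\1_A S)%:E)%E.
  by rewrite integral_indic// setIT.
(* Markov's inequality: [c * \prod_(u <- S) h u] is the exponential of [t] times the excess of the
   sum over [m%:R * t], hence at least 1 on [A]. *)
apply: (@le_trans _ _
    (\int[iid_sample P m]_S (c%:E * (\prod_(u <- S) h u)%:E))%E).
  apply: ge0_le_integral => //.
  - exact/measurable_EFinP/measurable_indic.
  - apply/measurable_EFinP; apply: measurable_funM => //.
    exact: measurable_prod_tuple.
  - move=> S _; rewrite -EFinM lee_fin indicE.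
    have -> : c * \prod_(u <- S) h u
        = expR (t * (\sum_(u <- S) (mu - X u) - m%:R * t)).
      rewrite /h -expR_sum /c -expRD -mulr_sumr; congr expR; ring.
    have [/set_mem SA|SA] := boolP (S \in A); last exact: expR_ge0.
    by rewrite -[leLHS]expR0 ler_expR mulr_ge0// subr_ge0.
rewrite ge0_integralZl//; last 2 first.
- by apply/measurable_EFinP; exact: measurable_prod_tuple.
- by move=> S _; rewrite lee_fin prodr_ge0.
rewrite integral_iid_prod//.
apply: (@le_trans _ _ (c%:E * (expR (t ^+ 2 / 2))%:E ^+ m)%E).
  apply: lee_wpmul2l; first by rewrite lee_fin.
  apply: lee_wexpe.
    by apply: integral_ge0 => x _; rewrite lee_fin.
  exact: centered_mgf_le.
rewrite -EFin_expe -EFinM lee_fin /c -expRM_natl -expRD ler_expR.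
by rewrite le_eqVlt; apply/orP; left; apply/eqP; field.
Qed.

End hoeffding.

(** * Finite maxima, and measurability of maxima and coordinates *)

Section fmax.
Context (R : realType) (I : finType).
Implicit Types F : I -> R.

Lemma fmax_ub F i : F i <= fmax F.
Proof.
apply: ub_le_sup; last by exists i.
exists (\sum_j `|F j|) => _ [j _ <-].
rewrite (le_trans (ler_norm _))// (bigD1 j)//= lerDl.
by apply: sumr_ge0.
Qed.

(** The point [i0] makes the range of [F] nonempty, so that its supremum is a genuine least upper
    bound. *)
Lemma fmax_le (i0 : I) F x : (forall i, F i <= x) -> fmax F <= x.
Proof.
move=> Fx; apply: ge_sup; first by exists (F i0), i0.
by move=> _ [i _ <-].
Qed.

(** Turns the supremum into an iterated binary maximum, for which measurability follows by
    induction. *)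
Lemma fmaxE (i0 : I) F : fmax F = \big[Num.max/F i0]_i F i.
Proof.
apply/eqP; rewrite eq_le; apply/andP; split.
  by apply: (fmax_le i0) => i; exact: le_bigmax_cond.
by apply/bigmax_leP; split => [|i _]; exact: fmax_ub.
Qed.

Lemma measurable_fmax (i0 : I) d (T : measurableType d) (F : I -> T -> R) :
  (forall i, measurable_fun setT (F i)) ->
  measurable_fun setT (fun x => fmax (F^~ x)).
Proof.
move=> mF; under eq_fun do rewrite (fmaxE i0).
elim: (index_enum I) => [|i s IHs].
  by under eq_fun do rewrite big_nil; exact: mF.
by under eq_fun do rewrite big_cons; exact: measurable_maxr.
Qed.

End fmax.

Section coord_systems.
Context (R : realType) (T I : Type) (x : I -> T -> R).

Lemma coord_system_preimage i (A : set R) :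
  measurable A -> coord_system x (x i @^-1` A).
Proof.
by move=> mA; apply: sub_gen_smallest; exists i => //; exists A; rewrite ?setTI.
Qed.

End coord_systems.

Section measurable_coords.
Context (R : realType) (n : nat) (k : 'I_n -> nat).

Lemma measurable_payoff_coord ia :
  measurable_fun setT (@payoff_coord R n k ia).
Proof. by move=> _ A mA; rewrite setTI; exact: coord_system_preimage. Qed.

Lemma measurable_joint_coord a : measurable_fun setT (@joint_coord R n k a).
Proof. by move=> _ A mA; rewrite setTI; exact: coord_system_preimage. Qed.

Lemma measurable_product_coord ia :
  measurable_fun setT (@product_coord R n k ia).
Proof. by move=> _ A mA; rewrite setTI; exact: coord_system_preimage. Qed.

End measurable_coords.

(** * Regret against a finite family of deviations *)

(* [exploit] and [exploitCE] are the instances where the deviations are the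
   constant maps, resp. all maps, of the action set of player [i]. *)
Section regret.
Context (R : realType) (n : nat) (k : 'I_n -> nat).
Implicit Types (p : joint_strategy R k) (u : payoff R k) (i : 'I_n).

Definition regret (I : finType) (dev : I -> profile k -> profile k) p u i : R :=
  fmax (fun t => \sum_a p a * u i (dev t a)) - exp_payoff p u i.

Context (I : finType) (t0 : I) (dev : I -> profile k -> profile k).

Let value_itv p u i (b : profile k -> profile k) :
  0 <= \sum_a p a * u i (b a) <= 1.
Proof.
apply/andP; split.
  apply: sumr_ge0 => a _; rewrite mulr_ge0 ?distr_ge0//.
  by have /andP[] := payoff_itv u i (b a).
rewrite -(distr_sum1 p); apply: ler_sum => a _.
rewrite ler_piMr ?distr_ge0//.
by have /andP[] := payoff_itv u i (b a).
Qed.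

Lemma regret_norm_le1 p u i : `|regret dev p u i| <= 1.
Proof.
have /andP[e0 e1] := value_itv p u i id.
have m0 : 0 <= fmax (fun t => \sum_a p a * u i (dev t a)).
  apply: le_trans (fmax_ub _ t0).
  by have /andP[] := value_itv p u i (dev t0).
have m1 : fmax (fun t => \sum_a p a * u i (dev t a)) <= 1.
  by apply: (fmax_le t0) => t; have /andP[] := value_itv p u i (dev t).
rewrite /regret /exp_payoff ler_norml.
by apply/andP; split; lra.
Qed.

(** For each deviation, the payoffs with and without it are paired before estimating: [p a - p' a]
    is then multiplied by a difference of two numbers in [0, 1], which gives the constant 1. Two
    separate estimates would give 2. *)
Lemma regret_le p p' u i :
  regret dev p u i <= regret dev p' u i + joint_dist p p'.
Proof.
rewrite /regret /exp_payoff lerBlDr; apply: (fmax_le t0) => t.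
have := fmax_ub (fun t => \sum_a p' a * u i (dev t a)) t.
have : \sum_a p a * u i (dev t a) - \sum_a p' a * u i (dev t a)
    - (\sum_a p a * u i a - \sum_a p' a * u i a) <= joint_dist p p'.
  rewrite -!sumrB; apply: ler_sum => a _.
  have -> : p a * u i (dev t a) - p' a * u i (dev t a)
      - (p a * u i a - p' a * u i a) = (p a - p' a) * (u i (dev t a) - u i a).
    by ring.
  rewrite (le_trans (ler_norm _))// normrM ler_piMr//.
  have /andP[] := payoff_itv u i (dev t a).
  have /andP[] := payoff_itv u i a.
  by rewrite ler_norml => *; apply/andP; split; lra.
lra.
Qed.

Lemma measurable_regret d (T : measurableType d)
    (p : T -> joint_strategy R k) (u : T -> payoff R k) i :
  (forall a, measurable_fun setT (fun x => p x a)) ->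
  (forall a, measurable_fun setT (fun x => u x i a)) ->
  measurable_fun setT (fun x => regret dev (p x) (u x) i).
Proof.
move=> mp mu; apply: measurable_funB.
  apply: (measurable_fmax t0) => t.
  by apply: measurable_sum => a; exact: measurable_funM.
by apply: measurable_sum => a; exact: measurable_funM.
Qed.

End regret.

(** * The l1 distance between product distributions *)

Section hybrid.
Context (R : realType).

(* Replacing the factors one at a time, from the left. *)
Lemma prod_dist_le n (x y : 'I_n -> R) :
  (forall i, 0 <= x i) -> (forall i, 0 <= y i) ->
  `|\prod_i x i - \prod_i y i| <=
  \sum_j \prod_i (if i == j then `|x i - y i|
                  else if (i < j)%N then y i else x i).
Proof.
elim: n x y => [|n IHn] x y x0 y0; first by rewrite !big_ord0 subrr normr0.
pose w (i : 'I_n) : 'I_n.+1 := widen_ord (leqnSn n) i.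
have prodS (z : 'I_n.+1 -> R) :
    \prod_i z i = \prod_(i < n) z (w i) * z ord_max by rewrite big_ord_recr.
rewrite (prodS x) (prodS y) [leRHS]big_ord_recr /=.
set X := \prod_(i < n) x _; set Y := \prod_(i < n) y _.
have Y0 : 0 <= Y by exact: prodr_ge0.
have -> : X * x ord_max - Y * y ord_max
    = (X - Y) * x ord_max + Y * (x ord_max - y ord_max) by ring.
rewrite (le_trans (ler_normD _ _))//; apply: lerD.
  rewrite normrM (ger0_norm (x0 _)).
  apply: (le_trans (ler_wpM2r (x0 _) (IHn (x \o w) (y \o w) _ _))) => [i|i|].
  - exact: x0.
  - exact: y0.
  rewrite mulr_suml; apply: ler_sum => j _.
  rewrite prodS [leRHS]mulrC [leLHS]mulrC /=.
  have -> : (ord_max == widen_ord (leqnSn n) j) = false.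
    by rewrite -val_eqE /= gtn_eqF.
  rewrite ltnNge (ltnW (ltn_ord j)) /=.
  by rewrite ler_wpM2l// le_eqVlt; apply/orP; left; apply/eqP; apply: eq_bigr.
rewrite normrM (ger0_norm Y0) prodS eqxx ler_wpM2r//.
rewrite le_eqVlt; apply/orP; left; apply/eqP; apply: eq_bigr => i _.
by rewrite -val_eqE /= ltn_eqF// ltn_ord.
Qed.

(** Stated for arbitrary real factors, because each term of the telescoping bound contains a factor
    [|s i x - s' i x|] that is not a distribution. *)
Lemma sum_prod_profile n (k : 'I_n -> nat) (P : forall i, action k i -> R) :
  \sum_(a : profile k) \prod_i P i (a i) = \prod_i \sum_x P i x.
Proof.
pose Q i := [ffun x => P i x].
transitivity (\prod_i \sum_x Q i x); last first.
  by apply: eq_bigr => i _; apply: eq_bigr => x _; rewrite ffunE.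
rewrite (eq_bigr _ (fun i _ => big_tag Q i)).
rewrite bigA_distr_big_dep -big_fprod (reindex (@dffun_of_fprod _ _)) /=.
  by apply: eq_bigr => f _; apply: eq_bigr => i _; rewrite !ffunE.
exact/onW_bij/dffun_of_fprod_bij.
Qed.

Context (n : nat) (k : 'I_n -> nat).
Implicit Types s : product_strategy R k.

(** In the [j]-th telescoping term, all factors but the [j]-th sum to 1 and the [j]-th sums to the
    l1 distance between the strategies of player [j]; there are [n] terms. *)
Lemma joint_of_product_dist s s' :
  joint_dist (joint_of_product s) (joint_of_product s')
  <= n%:R * product_dist s s'.
Proof.
rewrite /joint_dist /=.
pose P j i (x : action k i) : R := if i == j then `|s i x - s' i x|
  else if (i < j)%N then s' i x else s i x.
apply: (@le_trans _ _ (\sum_(a : profile k) \sum_j \prod_i P j i (a i))).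
  by apply: ler_sum => a _; apply: prod_dist_le => i; exact: distr_ge0.
rewrite exchange_big /= -[n in n%:R]card_ord -sum1_card natr_sum mulr_suml.
apply: ler_sum => j _; rewrite sum_prod_profile mul1r.
rewrite (bigD1 j)//=.
have P1 i : i != j -> \sum_x P j i x = 1 :> R.
  by move=> /negbTE ij; rewrite /P ij; case: (i < j)%N; exact: distr_sum1.
rewrite [X in _ * X](big1 _ _ _ P1) mulr1.
apply: le_trans (fmax_ub _ j).
by rewrite /P eqxx.
Qed.

End hybrid.

(** * Bounds, Lipschitz continuity and measurability of the equilibrium approximation *)

Section equilibrium_approximation.
Context (R : realType) (n : nat) (k : 'I_n -> nat) (i0 : 'I_n).

Lemma distr_l1_le2 (T : finType) (p q : distr R T) :
  \sum_x `|p x - q x| <= 2.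
Proof.
apply: (@le_trans _ _ (\sum_x (p x + q x))).
  apply: ler_sum => x _; rewrite (le_trans (ler_normB _ _))//.
  by rewrite !ger0_norm ?distr_ge0.
by rewrite big_split /= !distr_sum1.
Qed.

Lemma strategy_dist_le2 c (s s' : strategy R k c) : strategy_dist s s' <= 2.
Proof.
case: c s s' => s s'; try exact: distr_l1_le2.
by apply: (fmax_le i0) => i; exact: distr_l1_le2.
Qed.

Lemma strategy_dist_sym c (s s' : strategy R k c) :
  strategy_dist s s' = strategy_dist s' s.
Proof.
case: c s s' => s s' /=; rewrite /product_dist /joint_dist.
- by congr fmax; apply/funext => i; apply: eq_bigr => x _; rewrite distrC.
- by apply: eq_bigr => x _; rewrite distrC.
- by apply: eq_bigr => x _; rewrite distrC.
Qed.

Definition joint_of c : strategy R k c -> joint_strategy R k :=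
  match c with
  | NE => fun s => joint_of_product s
  | CE | CCE => fun p => p
  end.

Definition gain (c : solution_concept) :
    joint_strategy R k -> payoff R k -> 'I_n -> R :=
  match c with
  | NE | CCE => @exploit R n k
  | CE => @exploitCE R n k
  end.

Lemma eq_approxE c (s : strategy R k c) u :
  eq_approx s u = fmax (gain c (joint_of s) u).
Proof. by case: c s. Qed.

(** Lets one argument serve all three concepts. The deviations are indexed by the actions of player
    [i] for [NE] and [CCE], and by the self-maps of this action set for [CE]. *)
Lemma gain_regret c i :
  exists (I : finType) (_ : I) (dev : I -> profile k -> profile k),
  forall p u, gain c p u i = regret dev p u i.
Proof.
have coarse : exists (I : finType) (_ : I) (dev : I -> profile k -> profile k),
    forall (p : joint_strategy R k) u, exploit p u i = regret dev p u i.
  by exists (action k i), ord0; exists (fun b a => deviate a b).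
case: c => //=.
exists {ffun action k i -> action k i}, [ffun=> ord0].
by exists (fun (phi : {ffun _ -> _}) a => deviate a (phi (a i))).
Qed.

Lemma eq_approx_norm_le1 c (s : strategy R k c) u : `|eq_approx s u| <= 1.
Proof.
have g1 i : `|gain c (joint_of s) u i| <= 1.
  have [I [t0 [dev ->]]] := gain_regret c i.
  exact: regret_norm_le1.
rewrite eq_approxE ler_norml; apply/andP; split.
  apply: le_trans (fmax_ub _ i0).
  by have := g1 i0; rewrite ler_norml => /andP[].
by apply: (fmax_le i0) => i; have := g1 i; rewrite ler_norml => /andP[].
Qed.

Lemma joint_dist_joint_of c (s s' : strategy R k c) :
  joint_dist (joint_of s) (joint_of s')
  <= lip_const R n c / 2 * strategy_dist s s'.
Proof.
case: c s s' => s s' /=; last 2 first.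
- by rewrite divff ?pnatr_eq0// mul1r.
- by rewrite divff ?pnatr_eq0// mul1r.
have -> : (2 * n)%:R / 2 = n%:R :> R by rewrite natrM; field.
exact: joint_of_product_dist.
Qed.

(** Each regret is 1-Lipschitz in the joint strategy, a maximum over players preserves this, and
    [joint_dist_joint_of] supplies the constant. The one-sided bound suffices since the distance is
    symmetric. *)
Lemma eq_approx_lipschitz c (s s' : strategy R k c) u :
  `|eq_approx s u - eq_approx s' u|
  <= lip_const R n c / 2 * strategy_dist s s'.
Proof.
have le_s (q q' : strategy R k c) : eq_approx q u <=
    eq_approx q' u + lip_const R n c / 2 * strategy_dist q q'.
  rewrite !eq_approxE; apply: (fmax_le i0) => i.
  have [I [t0 [dev gE]]] := gain_regret c i.
  rewrite gE (le_trans (regret_le t0 _ _ (joint_of q') _ _))//.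
  by rewrite -gE lerD ?joint_dist_joint_of// fmax_ub.
rewrite ler_norml; apply/andP; split; last by rewrite lerBlDl.
by rewrite lerNl opprB lerBlDl strategy_dist_sym.
Qed.

Lemma measurable_joint_of c (f : approximator R k c) a :
  measurable_fun setT (fun u => joint_of (f u) a).
Proof.
have mf : measurable_fun setT f by exact: measurable_funP.
case: c f mf => f mf /=.
- apply: measurable_prod => i _.
  exact: (measurableT_comp
    (measurable_product_coord (Tagged (action k) (a i))) mf).
- exact: (measurableT_comp (measurable_joint_coord a) mf).
- exact: (measurableT_comp (measurable_joint_coord a) mf).
Qed.

Lemma measurable_eq_approx c (f : approximator R k c) :
  measurable_fun setT (fun u => eq_approx (f u) u).
Proof.
under eq_fun do rewrite eq_approxE.
apply: (@measurable_fmax R 'I_n i0 _ (payoff R k)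
  (fun i u => gain c (joint_of (f u)) u i)) => i.
have [I [t0 [dev gE]]] := gain_regret c i.
under eq_fun do rewrite gE.
apply: measurable_regret => // a; first exact: measurable_joint_of.
exact: (measurable_payoff_coord (i, a)).
Qed.

End equilibrium_approximation.

(** * Covers of minimal size and the sample size *)

Section covering_number.
Context (R : realType) (n : nat) (k : 'I_n -> nat) (c : solution_concept).
Variables (F : set (approximator R k c)) (r : R).

(** The infimum is over natural numbers: if it is finite, some cover size exists, and the least one
    realizes it. *)
Lemma covering_number_attained : covering_number F r != +oo%E ->
  exists N : nat, covering_number F r = N%:R%:E /\
    exists G, (G #= `I_N)%card /\ covers G F r.
Proof.
pose C := [set N : nat | exists G, (G #= `I_N)%card /\ covers G F r].
move=> cov_fin.
have [N0 CN0] : exists N, `[< C N >].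
  apply: contrapT => /forallNP noC; move/eqP: cov_fin; apply.
  rewrite /covering_number -/C (_ : C = set0) ?image_set0 ?ereal_inf0//.
  by apply/seteqP; split => // N CN; apply: (noC N); exact/asboolP.
have exC : exists N, `[< C N >] by exists N0.
case: (ex_minnP exC) => N /asboolP CN minN; exists N; split => //.
apply/eqP; rewrite eq_le; apply/andP; split.
  by apply: ereal_inf_lbound; exists N.
apply: le_ereal_inf_tmp => _ [M CM <-].
by rewrite lee_fin ler_nat; apply: minN; exact/asboolP.
Qed.

End covering_number.

(** The uniform bound 2 on distances ensures that the supremum defining [linfty] is a true upper
    bound. *)
Lemma strategy_dist_le_linfty (R : realType) n (k : 'I_n -> nat) c
    (i0 : 'I_n) (f g : approximator R k c) u :
  strategy_dist (f u) (g u) <= linfty f g.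
Proof.
apply: ub_le_sup; last by exists u.
by exists 2 => _ [v _ <-]; exact: strategy_dist_le2.
Qed.

(** Since [2 * eps ^+ 2 / 9] equals [(2 * eps / 3) ^+ 2 / 2], exponentiating the sample-size
    condition bounds [2 / delta * N%:R] by the inverse of the Hoeffding tail. *)
Lemma sample_size_tail (R : realType) (eps delta : R) (N m : nat) :
  0 < eps -> 0 < delta ->
  ((9 / (2 * eps ^+ 2))%:E * ((ln (2 / delta))%:E + lne N%:R%:E)
   <= (m%:R)%:E)%E ->
  N%:R * expR (- (m%:R * (2 * eps / 3) ^+ 2 / 2)) <= delta.
Proof.
move=> eps0 delta0.
(* The empty cover is treated apart: passing from [lne] to [ln] takes a positive argument. *)
have [->|N0] := posnP N; first by move=> _; rewrite mul0r ltW.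
have N0R : 0 < N%:R :> R by rewrite ltr0n.
rewrite lne_EFin// -EFinD -EFinM lee_fin.
rewrite -lnM ?posrE ?divr_gt0//.
have -> : 9 / (2 * eps ^+ 2) = (2 * eps ^+ 2 / 9)^-1 by rewrite invf_div.
rewrite mulrC ler_pdivrMr ?divr_gt0 ?mulr_gt0 ?exprn_gt0//.
have -> : m%:R * (2 * eps ^+ 2 / 9) = m%:R * (2 * eps / 3) ^+ 2 / 2 by field.
set y := m%:R * _ / 2 => le_y.
have : 2 / delta * N%:R <= expR y.
  by rewrite -[leLHS]lnK ?ler_expR// posrE mulr_gt0 ?divr_gt0.
rewrite mulrAC ler_pdivrMr// => N_le.
rewrite expRN ler_pdivrMr ?expR_gt0// mulrC; apply: le_trans N_le.
by rewrite ler_peMl ?ltW// ltr1n.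
Qed.

(** * Union bound over the cover, and transfer to the whole class *)

Section uniform_deviation.
Context d (T : measurableType d) (R : realType) (P : probability T R).

(** [Good] is the complement of the union of [N] Hoeffding events, so it is measurable by
    construction. *)
Lemma uniform_deviation (H : set (T -> R)) (N m : nat) (t delta : R) :
  (H #<= `I_N)%card ->
  (forall X, H X -> measurable_fun setT X) ->
  (forall X, H X -> forall x, `|X x| <= 1) ->
  0 <= t -> N%:R * expR (- (m%:R * t ^+ 2 / 2)) <= delta ->
  exists Good : set (m.-tuple T),
    [/\ measurable Good,
        ((1 - delta)%:E <= iid_sample P m Good)%E &
        forall S, Good S -> forall X, H X ->
          \sum_(u <- S) (fine 'E_P[X] - X u) < m%:R * t].
Proof.
move=> /pcard_surjP[phi Hphi] mH H1 t0 tail.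
(* The surjection [phi] only has to reach every element of [H]; values outside [H] become the zero
   function, so that Hoeffding's inequality applies to every index. *)
pose X j : T -> R := if `[< H (phi j) >] then phi j else cst 0.
have mX j : measurable_fun setT (X j) by rewrite /X; case: asboolP => // /mH.
have X1 j x : `|X j x| <= 1.
  by rewrite /X; case: asboolP => [/H1//|_]; rewrite normr0.
pose A j := [set S : m.-tuple T |
  m%:R * t <= \sum_(u <- S) (fine 'E_P[X j] - X j u)].
have mA j : measurable (A j).
  rewrite -[A j]setTI; apply: (measurable_fun_le (f := cst (m%:R * t))) => //.
  by apply: measurable_sum_tuple; exact: measurable_funB.
pose Bad := \big[setU/set0]_(j < N) A j.
have mBad : measurable Bad by exact: bigsetU_measurable.
exists (~` Bad); split; first exact: measurableC.
  rewrite probability_setC// EFinB leeB// (le_trans (Boole_inequality _ _))//.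
  apply: (@le_trans _ _
    (\sum_(j < N) (expR (- (m%:R * t ^+ 2 / 2)))%:E)%E).
        by apply: lee_sum => j _; exact: hoeffding.
  by rewrite sumEFin lee_fin sumr_const card_ord -[leLHS]mulr_natl.
move=> S BadS Y HY; have [j jN phij] := Hphi _ HY.
have XjY : X j = Y by rewrite /X phij asboolT.
rewrite ltNge; apply/negP => AS; apply: BadS.
by rewrite /Bad -bigcup_mkord; exists j => //; rewrite /A /= XjY.
Qed.

End uniform_deviation.

Theorem theorem4p4 (R : realType) (n : nat) (k : 'I_n -> nat)
    (c : solution_concept) (F : set (approximator R k c))
    (D : probability (payoff R k) R) (eps delta : R) (m : nat) :
  (2 <= n)%N ->
  0 < eps < 1 ->
  0 < delta < 1 ->
  ((9 / (2 * eps ^+ 2))%:E *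
    ((ln (2 / delta))%:E
     + lne (covering_number F (eps / (3 * lip_const R n c))))
   <= (m%:R)%:E)%E ->
  exists Good : set (m.-tuple (payoff R k)),
    [/\ measurable Good,
        ((1 - delta)%:E <= iid_sample D m Good)%E &
        forall S, Good S -> forall f, F f ->
          ('E_D[fun u => eq_approx (f u) u]
           <= (m%:R^-1 * (\sum_(u <- S) eq_approx (f u) u) + eps)%:E)%E].
Proof.
move=> n2 /andP[eps0 eps1] /andP[delta0 delta1] mN.
have i0 : 'I_n := Ordinal (ltnW n2).
set r := eps / _ in mN.
have eps2 : 0 < 9 / (2 * eps ^+ 2) :> R.
  by rewrite divr_gt0// mulr_gt0// exprn_gt0.
have [|N [covN [G [GN GF]]]] := @covering_number_attained R n k c F r.
  (* An infinite covering number would make the left side of the sample-size condition [+oo]. *)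
  by apply: contraPN mN => /eqP ->; rewrite /= addey// mulry gtr0_sg// mul1e.
have mN' := mN; rewrite covN in mN'.
have tail := sample_size_tail eps0 delta0 mN'.
pose H := [set (fun u => eq_approx (g u) u) | g in G].
have HN : (H #<= `I_N)%card.
  apply: card_le_trans (card_image_le _ _) _.
  by move: GN; rewrite card_eq_le => /andP[].
have mH X : H X -> measurable_fun setT X.
  by move=> [g _ <-]; exact: measurable_eq_approx.
have H1 X : H X -> forall u, `|X u| <= 1.
  by move=> [g _ <-] u; exact: eq_approx_norm_le1.
have t0 : 0 <= 2 * eps / 3 by lra.
have [Good [mGood PGood dev]] := uniform_deviation D HN mH H1 t0 tail.
exists Good; split => // S GS f Ff.
have [g Gg fg] := GF f Ff.
(* If [m] were 0, the sample would be empty and the strict deviation bound for [g] would read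
   [0 < 0]. *)
have m0 : 0 < m%:R :> R.
  have := dev S GS _ (ex_intro2 _ _ g Gg erefl).
  rewrite ltr0n lt0n; apply: contraPneq => m0.
  have -> : tval S = [::] by apply: size0nil; rewrite size_tuple.
  by rewrite big_nil m0 mul0r ltxx.
set X := fun u => eq_approx (f u) u; set Y := fun u => eq_approx (g u) u.
(* The Lipschitz constant [L / 2] times the radius [eps / (3 * L)] is [eps / 6]. *)
have XY u : `|X u - Y u| <= eps / 6.
  rewrite (le_trans (eq_approx_lipschitz i0 _ _ _))//.
  have L0 : 0 < lip_const R n c.
    by case: (c); rewrite ?ltr0n //= muln_gt0 /= (ltnW n2).
  have -> : eps / 6 = lip_const R n c / 2 * r.
    by rewrite /r; field; rewrite gt_eqF.
  rewrite ler_wpM2l ?divr_ge0 ?(ltW L0)//.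
  by apply: le_trans fg; exact: strategy_dist_le_linfty.
have mX : measurable_fun setT X by exact: measurable_eq_approx.
have mY : measurable_fun setT Y by exact: measurable_eq_approx.
have X1 u : `|X u| <= 1 by exact: eq_approx_norm_le1.
have Y1 u : `|Y u| <= 1 by exact: eq_approx_norm_le1.
rewrite -(expectation_fineK D mX X1) lee_fin.
have EXY : fine 'E_D[X] <= fine 'E_D[Y] + eps / 6.
  apply: (fine_expectation_leD D mX mY X1 Y1) => u.
  by have := XY u; rewrite ler_norml => /andP[]; lra.
have := dev S GS Y (ex_intro2 _ _ g Gg erefl).
rewrite sumrB big_const_seq count_predT iter_addr_0 size_tuple.
rewrite -[fine _ *+ m]mulr_natl.
rewrite ltrBlDl => sumY.
have sumYX : \sum_(u <- S) Y u <= \sum_(u <- S) X u + m%:R * (eps / 6).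
  have -> : m%:R * (eps / 6) = \sum_(u <- S) (eps / 6).
    by rewrite big_const_seq count_predT iter_addr_0 size_tuple mulr_natl.
  rewrite -big_split /=; apply: ler_sum => u _.
  by have := XY u; rewrite ler_norml => /andP[]; lra.
(* After multiplication by [m], the errors [eps / 6] (expectation), [2 * eps / 3] (deviation) and
   [eps / 6] (sample mean) add up to [eps]. *)
rewrite -(ler_pM2l m0) mulrDr mulVKf ?gt_eqF//.
rewrite -(ler_pM2l m0) in EXY.
lra.
Qed.
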